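(* Let $n,k$ be integers with $1<k<n$, and let $$\psi(z)=\frac{1}{2\pi i}\int_{|w|=1}w^{k-2}\exp\left\{\frac{z}{w}-\frac{1}{(n-k+1)w^{n-k+1}}-\frac{w^{k-1}}{k-1}\right\}dw .$$ Then $\psi$ is real on the real axis. If, in addition, $n$ is even and $k$ is odd, then $\psi$ is also real on the imaginary axis.
   Context: The circle $|w|=1$ is traversed once counterclockwise. ''Real on'' a set means that $\psi$ takes real values at every point of that set. *)

(* Defs.v *)
From Stdlib Require Import Reals.
From Coquelicot Require Import Coquelicot.

Local Open Scope C_scope.

Definition Cexp (z : C) : C :=
  RtoC (exp (Re z)) * (RtoC (cos (Im z)) + Ci * RtoC (sin (Im z))).

(* Integral of [f] over |w| = 1, traversed once counterclockwise: the pullback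
   along w = e^(it), for which dw = i e^(it) dt. *)
Definition Cint_circle (f : C -> C) : C :=
  RInt (V := C_R_CompleteNormedModule)
    (fun t : R => f (Cexp (Ci * RtoC t)) * (Ci * Cexp (Ci * RtoC t)))
    0%R (2 * PI)%R.

(* The subtractions in [nat] are exact for 1 < k < n. *)
Definition psi (n k : nat) (z : C) : C :=
  1 / (2 * RtoC PI * Ci) *
  Cint_circle (fun w : C =>
    w ^ (k - 2) *
    Cexp (z / w
          - 1 / (RtoC (INR (n - k + 1)) * w ^ (n - k + 1))
          - w ^ (k - 1) / RtoC (INR (k - 1)))).

Definition real_on (f : C -> C) (S : C -> Prop) : Prop :=
  forall z : C, S z -> Im (f z) = 0%R.

Definition real_axis (z : C) : Prop := Im z = 0%R.

Definition imaginary_axis (z : C) : Prop := Re z = 0%R.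

(* Main.v *)
(** On the circle, [w -> conj w] commutes with the integrand up to conjugation when
    [z] is real, and so does [w -> - conj w], up to conjugation and sign, when [z] is
    imaginary, [n] even and [k] odd. Both maps reverse the orientation, so the
    integral [I] satisfies [I = - conj I]; hence [I] is imaginary and
    [I / (2 pi i)] is real. *)

Require Import Defs.
From Stdlib Require Import Reals Lra Lia.
From Coquelicot Require Import Coquelicot.

Local Open Scope R_scope.

(** * Continuity of complex-valued functions of a real variable *)

(* Componentwise, because Coquelicot has two uniform structures on [C], and its
   product rule and its [C]-valued [RInt] do not use the same one. *)
Definition continuous_components (f : R -> C) (t : R) : Prop :=
  continuous (fun s => Re (f s)) t /\ continuous (fun s => Im (f s)) t.

Lemma continuous_components_const (c : C) (t : R) :
  continuous_components (fun _ => c) t.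
Proof. split; apply continuous_const. Qed.

Lemma continuous_components_RtoC (f : R -> R) (t : R) :
  continuous f t -> continuous_components (fun s => RtoC (f s)) t.
Proof. intros Hf; split; [exact Hf | apply continuous_const]. Qed.

Lemma continuous_components_plus (f g : R -> C) (t : R) :
  continuous_components f t -> continuous_components g t ->
  continuous_components (fun s => (f s + g s)%C) t.
Proof.
  intros [Hf1 Hf2] [Hg1 Hg2]; split.
  - exact (continuous_plus _ _ _ Hf1 Hg1).
  - exact (continuous_plus _ _ _ Hf2 Hg2).
Qed.

Lemma continuous_components_opp (f : R -> C) (t : R) :
  continuous_components f t -> continuous_components (fun s => (- f s)%C) t.
Proof.
  intros [Hf1 Hf2]; split.
  - exact (continuous_opp _ _ Hf1).
  - exact (continuous_opp _ _ Hf2).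
Qed.

Lemma continuous_components_mult (f g : R -> C) (t : R) :
  continuous_components f t -> continuous_components g t ->
  continuous_components (fun s => (f s * g s)%C) t.
Proof.
  intros [Hf1 Hf2] [Hg1 Hg2]; split.
  - exact (continuous_minus _ _ _ (continuous_mult _ _ _ Hf1 Hg1)
             (continuous_mult _ _ _ Hf2 Hg2)).
  - exact (continuous_plus _ _ _ (continuous_mult _ _ _ Hf1 Hg2)
             (continuous_mult _ _ _ Hf2 Hg1)).
Qed.

Lemma continuous_components_pow (f : R -> C) (m : nat) (t : R) :
  continuous_components f t -> continuous_components (fun s => (f s ^ m)%C) t.
Proof.
  intros Hf; induction m as [|m IH].
  - apply (continuous_components_const 1).
  - exact (continuous_components_mult _ _ _ Hf IH).
Qed.

Lemma continuous_components_inv (f : R -> C) (t : R) :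
  f t <> 0 -> continuous_components f t ->
  continuous_components (fun s => (/ f s)%C) t.
Proof.
  intros Hnz [Hf1 Hf2].
  assert (Hden : continuous (fun s => / (fst (f s) ^ 2 + snd (f s) ^ 2)) t).
  { apply continuous_Rinv_comp.
    - apply (continuous_plus (V := R_NormedModule)).
      + exact (continuous_mult _ _ _ Hf1
          (continuous_mult _ _ _ Hf1 (continuous_const _ _))).
      + exact (continuous_mult _ _ _ Hf2
          (continuous_mult _ _ _ Hf2 (continuous_const _ _))).
    - intros H0; apply Hnz.
      pose proof (pow2_ge_0 (fst (f t))); pose proof (pow2_ge_0 (snd (f t))).
      apply injective_projections; apply Rsqr_0_uniq; rewrite Rsqr_pow2; lra. }
  split.
  - exact (continuous_mult _ _ _ Hf1 Hden).
  - exact (continuous_mult _ _ _ (continuous_opp _ _ Hf2) Hden).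
Qed.

Lemma continuous_components_Cexp (f : R -> C) (t : R) :
  continuous_components f t -> continuous_components (fun s => Cexp (f s)) t.
Proof.
  intros [Hf1 Hf2]; unfold Cexp.
  apply continuous_components_mult; [| apply continuous_components_plus;
    [| apply continuous_components_mult; [apply continuous_components_const |]]];
    apply continuous_components_RtoC.
  - exact (continuous_exp_comp _ _ Hf1).
  - exact (continuous_cos_comp _ _ Hf2).
  - exact (continuous_sin_comp _ _ Hf2).
Qed.

(** * Real parts of integrals and reflection of the interval *)

Lemma is_RInt_continuous_components (g : R -> C) (a b : R) :
  (forall t, continuous_components g t) ->
  is_RInt (fun t => Re (g t)) a b
    (Re (RInt (V := C_R_CompleteNormedModule) g a b)).
Proof.
  intros Hg.
  apply (is_RInt_fct_extend_fst (U := R_NormedModule) (V := R_NormedModule)).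
  apply (RInt_correct (V := C_R_CompleteNormedModule)).
  apply (ex_RInt_fct_extend_pair (U := R_NormedModule) (V := R_NormedModule));
    apply (ex_RInt_continuous (V := R_CompleteNormedModule)); intros t _;
    apply (Hg t).
Qed.

(** The substitution [t -> a + b - t] exchanges the endpoints, and its factor -1 cancels the sign of
    [h]. So [l] is also the integral from [b] to [a], whence [l = - l]. *)
Lemma is_RInt_antisymmetric (h : R -> R) (a b l : R) :
  (forall t, h (a + b - t) = - h t) -> is_RInt h a b l -> l = 0.
Proof.
  intros Hh Hl.
  assert (Hl' : is_RInt h b a l).
  { apply is_RInt_ext with (fun t => scal (-1) (h (-1 * t + (a + b)))).
    - intros t _.
      replace (-1 * t + (a + b)) with (a + b - t) by ring.
      rewrite Hh; unfold scal; simpl; unfold mult; simpl; ring.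
    - apply (is_RInt_comp_lin (V := R_NormedModule)).
      replace (-1 * b + (a + b)) with a by ring.
      replace (-1 * a + (a + b)) with b by ring.
      exact Hl. }
  apply is_RInt_swap in Hl'.
  apply (is_RInt_unique (V := R_CompleteNormedModule)) in Hl.
  apply (is_RInt_unique (V := R_CompleteNormedModule)) in Hl'.
  rewrite Hl in Hl'; unfold opp in Hl'; simpl in Hl'; lra.
Qed.

(** * The unit circle and its symmetries *)

Lemma Cexp_conj (z : C) : Cexp (Cconj z) = Cconj (Cexp z).
Proof.
  unfold Cexp; rewrite re_conj, im_conj, cos_neg, sin_neg.
  apply injective_projections; simpl; ring.
Qed.

Lemma Cexp_Ci (t : R) : Cexp (Ci * RtoC t) = (cos t, sin t).
Proof.
  unfold Cexp.
  replace (Re (Ci * RtoC t)) with 0 by (simpl; ring).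
  replace (Im (Ci * RtoC t)) with t by (simpl; ring).
  rewrite exp_0; apply injective_projections; simpl; ring.
Qed.

Lemma Cexp_Ci_neq_0 (t : R) : Cexp (Ci * RtoC t) <> 0.
Proof.
  rewrite Cexp_Ci; intros H; injection H; intros Hs Hc.
  pose proof (sin2_cos2 t) as H1; rewrite Hs, Hc in H1; unfold Rsqr in H1; lra.
Qed.

Lemma continuous_components_Cexp_Ci (t : R) :
  continuous_components (fun s => Cexp (Ci * RtoC s)) t.
Proof.
  apply continuous_components_Cexp, continuous_components_mult;
    [apply continuous_components_const |].
  apply continuous_components_RtoC, continuous_id.
Qed.

Lemma continuous_components_circle (f : C -> C) (t : R) :
  continuous_components (fun s => f (Cexp (Ci * RtoC s))) t ->
  continuous_components
    (fun s => (f (Cexp (Ci * RtoC s)) * (Ci * Cexp (Ci * RtoC s)))%C) t.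
Proof.
  intros Hf; apply continuous_components_mult; [exact Hf |].
  apply continuous_components_mult;
    [apply continuous_components_const | apply continuous_components_Cexp_Ci].
Qed.

(** In the parameter, [w -> conj w] is [t -> 2 PI - t]. The factor [i w] goes to
    [i conj w = - conj (i w)], so the whole pullback goes to minus its conjugate and its real part
    is odd about [PI]. *)
Lemma Re_Cint_circle_conj (f : C -> C) :
  (forall t, continuous_components (fun s => f (Cexp (Ci * RtoC s))) t) ->
  (forall w : C, w <> 0 -> f (Cconj w) = Cconj (f w)) ->
  Re (Cint_circle f) = 0.
Proof.
  intros Hc Hf; unfold Cint_circle.
  refine (is_RInt_antisymmetric _ _ _ _ _ (is_RInt_continuous_components _ _ _
    (fun t => continuous_components_circle f t (Hc t)))).
  intros t; cbv beta.
  replace (Cexp (Ci * RtoC (0 + 2 * PI - t))) with (Cconj (Cexp (Ci * RtoC t))).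
  - rewrite Hf by apply Cexp_Ci_neq_0; simpl; ring.
  - rewrite !Cexp_Ci; unfold Cconj; simpl.
    replace (0 + 2 * PI - t) with (- t + 2 * INR 1 * PI) by (simpl; ring).
    now rewrite cos_period, sin_period, cos_neg, sin_neg.
Qed.

(** Here [i w] goes to [- i conj w = conj (i w)], so the minus sign comes from [f] instead of from
    [dw]. The parameter map is [t -> PI - t] modulo [2 PI], which does not reflect the interval from
    0 to [2 PI] onto itself; hence the split at [PI]. *)
Lemma Re_Cint_circle_opp_conj (f : C -> C) :
  (forall t, continuous_components (fun s => f (Cexp (Ci * RtoC s))) t) ->
  (forall w : C, w <> 0 -> f (- Cconj w)%C = (- Cconj (f w))%C) ->
  Re (Cint_circle f) = 0.
Proof.
  intros Hc Hf; unfold Cint_circle.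
  set (g := fun t : R => (f (Cexp (Ci * RtoC t)) * (Ci * Cexp (Ci * RtoC t)))%C).
  assert (Hg : forall t, continuous_components g t).
  { intros t; apply continuous_components_circle, Hc. }
  assert (Hrefl : forall s t, cos s = - cos t -> sin s = sin t ->
    Re (g s) = - Re (g t)).
  { intros s t Hcos Hsin; unfold g.
    replace (Cexp (Ci * RtoC s)) with (- Cconj (Cexp (Ci * RtoC t)))%C.
    - rewrite Hf by apply Cexp_Ci_neq_0; simpl; ring.
    - rewrite !Cexp_Ci, Hcos, Hsin.
      apply injective_projections; simpl; ring. }
  (* [w -> - conj w] fixes the upper and the lower half circle separately. *)
  assert (Hup : Re (RInt (V := C_R_CompleteNormedModule) g 0 PI) = 0).
  { refine (is_RInt_antisymmetric _ _ _ _ _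
      (is_RInt_continuous_components _ _ _ Hg)).
    intros t; apply Hrefl; rewrite Rplus_0_l.
    - apply Rtrigo_facts.cos_pi_minus.
    - apply sin_PI_x. }
  assert (Hlow : Re (RInt (V := C_R_CompleteNormedModule) g PI (2 * PI)) = 0).
  { refine (is_RInt_antisymmetric _ _ _ _ _
      (is_RInt_continuous_components _ _ _ Hg)).
    (* The reflection of the lower half is [t -> 3 PI - t], which is [PI - t] up to one period. *)
    intros t; replace (PI + 2 * PI - t) with (PI - t + 2 * INR 1 * PI)
      by (simpl; ring).
    apply Hrefl.
    - rewrite cos_period; apply Rtrigo_facts.cos_pi_minus.
    - rewrite sin_period; apply sin_PI_x. }
  pose proof (is_RInt_Chasles (V := R_NormedModule) _ _ _ _ _ _
    (is_RInt_continuous_components g 0 PI Hg)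
    (is_RInt_continuous_components g PI (2 * PI) Hg)) as Hsum.
  apply (is_RInt_unique (V := R_CompleteNormedModule)) in Hsum.
  pose proof (is_RInt_continuous_components g 0 (2 * PI) Hg) as Hall.
  apply (is_RInt_unique (V := R_CompleteNormedModule)) in Hall.
  rewrite Hall, Hup, Hlow in Hsum.
  rewrite Hsum; apply Rplus_0_l.
Qed.

Lemma Im_div_2PI_Ci (c : C) :
  Re c = 0 -> Im (1 / (2 * RtoC PI * Ci) * c) = 0.
Proof.
  intros Hc; rewrite im_mult, Hc; simpl.
  pose proof PI_neq0; field; lra.
Qed.

Lemma Cpow_opp_even (a : C) (m : nat) : Nat.Even m -> ((- a) ^ m = a ^ m)%C.
Proof.
  intros [j ->]; rewrite !Cpow_mult_r; f_equal; ring.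
Qed.

Lemma Cpow_opp_odd (a : C) (m : nat) : Nat.Odd m -> ((- a) ^ m = - a ^ m)%C.
Proof.
  intros [j ->]; rewrite !Cpow_add_r, !Cpow_1_r, Cpow_opp_even by now exists j.
  ring.
Qed.

Lemma Cconj_RtoC (x : R) : Cconj (RtoC x) = RtoC x.
Proof. unfold Cconj, RtoC; simpl; now rewrite Ropp_0. Qed.

Lemma RtoC_INR_neq_0 (m : nat) : (0 < m)%nat -> RtoC (INR m) <> 0.
Proof. intros Hm H; apply RtoC_inj in H; revert H; apply not_0_INR; lia. Qed.

(** * Symmetries of the integrand *)

Definition psi_integrand (n k : nat) (z w : C) : C :=
  (w ^ (k - 2) *
   Cexp (z / w
         - 1 / (RtoC (INR (n - k + 1)) * w ^ (n - k + 1))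
         - w ^ (k - 1) / RtoC (INR (k - 1))))%C.

Lemma continuous_components_psi_integrand (n k : nat) (z : C) (t : R) :
  continuous_components (fun s => psi_integrand n k z (Cexp (Ci * RtoC s))) t.
Proof.
  pose proof (continuous_components_Cexp_Ci t) as Hw.
  apply continuous_components_mult; [now apply continuous_components_pow |].
  apply continuous_components_Cexp, continuous_components_plus;
    [apply continuous_components_plus |].
  - apply continuous_components_mult; [apply continuous_components_const |].
    apply continuous_components_inv; [apply Cexp_Ci_neq_0 | exact Hw].
  - apply continuous_components_opp, continuous_components_mult;
      [apply continuous_components_const |].
    apply continuous_components_inv.
    + apply Cmult_neq_0; [apply RtoC_INR_neq_0; lia |].
      apply Cpow_nz, Cexp_Ci_neq_0.
    + apply continuous_components_mult; [apply continuous_components_const |].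
      now apply continuous_components_pow.
  - apply continuous_components_opp, continuous_components_mult;
      [now apply continuous_components_pow | apply continuous_components_const].
Qed.

(** All coefficients are real, so conjugation passes through every operation once the denominators
    are known to be nonzero. *)
Lemma psi_integrand_conj (n k : nat) (z w : C) :
  (1 < k)%nat -> w <> 0 ->
  psi_integrand n k (Cconj z) (Cconj w) = Cconj (psi_integrand n k z w).
Proof.
  intros Hk Hw; unfold psi_integrand.
  assert (Hm : RtoC (INR (n - k + 1)) <> 0) by (apply RtoC_INR_neq_0; lia).
  assert (Hk1 : RtoC (INR (k - 1)) <> 0) by (apply RtoC_INR_neq_0; lia).
  rewrite Cmult_conj, <- Cexp_conj, !Cminus_conj, !Cdiv_conj, Cmult_conj,
    !Cpow_conj, !Cconj_RtoC by auto using Cmult_neq_0, Cpow_nz.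
  reflexivity.
Qed.

(** The quotient [z / w] does not change when both signs do. The exponents [n - k + 1] and [k - 1]
    are even, so the whole exponential is unchanged, and the sign comes from the odd power
    [w ^ (k - 2)]. *)
Lemma psi_integrand_opp (n k : nat) (z w : C) :
  (1 < k)%nat -> (k < n)%nat -> Nat.Even n -> Nat.Odd k -> w <> 0 ->
  psi_integrand n k (- z)%C (- w)%C = (- psi_integrand n k z w)%C.
Proof.
  intros Hk Hkn [i Hi] [j Hj] Hw; unfold psi_integrand.
  (* With [n = 2 i] and [k = 2 j + 1], the bounds [1 < k < n] give [1 <= j < i], so neither [j - 1]
     nor [i - j] is truncated. *)
  rewrite (Cpow_opp_odd w (k - 2)) by (exists (j - 1)%nat; lia).
  rewrite (Cpow_opp_even w (n - k + 1)) by (exists (i - j)%nat; lia).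
  rewrite (Cpow_opp_even w (k - 1)) by (exists j; lia).
  replace (- z / - w)%C with (z / w)%C by (field; exact Hw).
  ring.
Qed.

Theorem theorem9 (n k : nat) (hk : (1 < k)%nat) (hkn : (k < n)%nat) :
  real_on (psi n k) real_axis /\
  (Nat.Even n -> Nat.Odd k -> real_on (psi n k) imaginary_axis).
Proof.
  split.
  - intros z Hz; apply Im_div_2PI_Ci.
    apply (Re_Cint_circle_conj (psi_integrand n k z)).
    + intros t; apply continuous_components_psi_integrand.
    (* Conjugation fixes a real [z], so the joint symmetry in [z] and [w] becomes one in [w]
       alone. *)
    + intros w Hw; rewrite <- psi_integrand_conj by assumption.
      f_equal; red in Hz.
      apply injective_projections; simpl; unfold Im in Hz; lra.
  - intros Hn Hkodd z Hz; apply Im_div_2PI_Ci.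
    apply (Re_Cint_circle_opp_conj (psi_integrand n k z)).
    + intros t; apply continuous_components_psi_integrand.
    (* Conjugation followed by negation fixes an imaginary [z]; the second rewrite is applied at
       [conj w], which must then be shown nonzero. *)
    + intros w Hw; rewrite <- psi_integrand_conj by assumption.
      rewrite <- psi_integrand_opp; try assumption.
      * f_equal; red in Hz.
        apply injective_projections; simpl; unfold Re in Hz; lra.
      * intros H0; apply Hw; rewrite <- (Cconj_conj w), H0; apply Cconj_RtoC.
Qed.
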